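(* Let $n\ge 2$ and put $M=2(2n^2-n)$. Given a pair $(A,B)$ of integers with $A+B\ge M$ and $A,B\ge 2$, there exist rational mappings from the unit sphere $S^{2n-1}\subset\mathbf{C}^n$ to the hyperquadric $Q(A,B-1)$ whose images lie in no complex hyperplane and whose degrees can be chosen arbitrarily large.
   Context: For non-negative integers $a,b$, $$Q(a,b)=\Big\{z\in\mathbf{C}^{a+b}:\ \sum_{j=1}^a|z_j|^2-\sum_{j=a+1}^{a+b}|z_j|^2=1\Big\}.$$ A rational mapping from $S^{2n-1}$ to $Q(a,b)$ is a map $F=g/h$ with $g:\mathbf{C}^n\to\mathbf{C}^{a+b}$ and $h:\mathbf{C}^n\to\mathbf{C}$ holomorphic polynomials, $h\not\equiv 0$, reduced to lowest terms, such that $F(z)\in Q(a,b)$ for every $z\in S^{2n-1}$ with $h(z)\ne 0$. Its degree is the maximum of the degrees of $h$ and of the components of $g$ (equivalently, the degree of the induced rational map of projective spaces in homogeneous coordinates). Complex hyperplanes are affine complex hyperplanes of $\mathbf{C}^{a+b}$; the condition that the image lies in no complex hyperplane is equivalent to linear independence of the components of the mapping written in homogeneous coordinates, i.e. of $h$ together with the components of $g$. *)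

(* Defs.v *)
From HB Require Import structures.
From mathcomp Require Import all_boot all_order all_algebra.
From mathcomp Require Export complex mpoly.
From mathcomp Require Export reals.

Set Implicit Arguments.
Unset Strict Implicit.
Unset Printing Implicit Defensive.

Import Order.TTheory GRing.Theory Num.Theory.
Local Open Scope ring_scope.

(* [`|w| : R[i]] is the modulus embedded in R[i], so the defining equations of
   the sphere and of the hyperquadric are stated in R[i]. *)
Definition unit_sphere (R : realType) (n : nat) : {pred 'rV[R[i]]_n} :=
  [pred z : 'rV[R[i]]_n | \sum_(j < n) `|z 0 j| ^+ 2 == 1].

Definition hyperquadric (R : realType) (a b : nat) :
    {pred 'rV[R[i]]_(a + b)} :=
  [pred w : 'rV[R[i]]_(a + b) |
    \sum_(j < a) `|w 0 (lshift b j)| ^+ 2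
    - \sum_(j < b) `|w 0 (rshift a j)| ^+ 2 == 1].

(* An affine complex hyperplane when [c != 0]. *)
Definition affine_hyperplane (R : realType) (N : nat) (c : 'rV[R[i]]_N)
    (d : R[i]) : {pred 'rV[R[i]]_N} :=
  [pred w : 'rV[R[i]]_N | \sum_(j < N) c 0 j * w 0 j == d].

Definition mpoly_dvd (R : realType) (n : nat) (d p : {mpoly R[i][n]}) : Prop :=
  exists q : {mpoly R[i][n]}, p = q * d.

(* The units of [{mpoly R[i][n]}] are the nonzero constants. *)
Record rational_map (R : realType) (n N : nat) := RationalMap {
  rnum : 'I_N -> {mpoly R[i][n]};
  rden : {mpoly R[i][n]};
  rden_neq0 : rden != 0;
  rlowest_terms : forall d : {mpoly R[i][n]},
    mpoly_dvd d rden -> (forall k : 'I_N, mpoly_dvd d (rnum k)) ->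
    d \is a GRing.unit
}.

Definition in_domain (R : realType) (n N : nat) (F : rational_map R n N) :
    {pred 'rV[R[i]]_n} :=
  [pred z : 'rV[R[i]]_n | (rden F).@[fun j => z 0 j] != 0].

(* Meaningful only at points of [in_domain F]. *)
Definition reval (R : realType) (n N : nat) (F : rational_map R n N)
    (z : 'rV[R[i]]_n) : 'rV[R[i]]_N :=
  \row_(k < N) ((rnum F k).@[fun j => z 0 j] / (rden F).@[fun j => z 0 j]).

(* [msize p] is one more than the total degree of [p] when [p != 0], and
   [msize 0 = 0]. *)
Definition rdegree (R : realType) (n N : nat) (F : rational_map R n N) : nat :=
  maxn (msize (rden F)).-1 (\max_(k < N) (msize (rnum F k)).-1)%N.

Definition maps_sphere_to_hyperquadric (R : realType) (n a b : nat)
    (F : rational_map R n (a + b)) : Prop :=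
  forall z : 'rV[R[i]]_n, z \in @unit_sphere R n -> z \in in_domain F ->
    reval F z \in @hyperquadric R a b.

Definition image_in_no_hyperplane (R : realType) (n N : nat)
    (F : rational_map R n N) : Prop :=
  forall (c : 'rV[R[i]]_N) (d : R[i]), c != 0 ->
    ~ (forall z : 'rV[R[i]]_n, z \in @unit_sphere R n -> z \in in_domain F ->
         reval F z \in affine_hyperplane c d).

(* Main.v *)
Require Import Defs.
From mathcomp Require Import all_boot all_order all_algebra.
From mathcomp Require Import zify ring.

(* With [x_j = |z_j|^2], a polynomial [(x_1 + ... + x_n - 1) q(x)] with [A]
   positive and [B] negative coefficients vanishes on the sphere; taking square
   roots of the absolute values of its coefficients as weights of the monomials
   [z^m], and one negative term as denominator, gives a rational map to
   [Q(A, B - 1)]. A nonzero constant term makes it reduced, and distinct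
   monomials are linearly independent on a torus inside the sphere, so the image
   lies in no hyperplane.

   For [q = sum_k lambda_k x_1^k] the coefficients are
   [lambda_(k-1) - lambda_k] at [x_1^k] and [lambda_k] at [x_1^k x_j] with
   [j > 1], so that [A = (n - 1) #{lambda_k > 0} + #{descents of lambda}] and
   [B = (n - 1) #{lambda_k < 0} + #{ascents of lambda}]. Suitable finitely
   supported sequences exist as soon as [A >= 2n^2 - n] and [B >= 2]; an
   arbitrarily long gap of zeros makes the degree arbitrarily large. Exchanging
   the signs covers the case [B >= 2n^2 - n]. *)

Set Implicit Arguments.
Unset Strict Implicit.
Unset Printing Implicit Defensive.

Import Order.TTheory GRing.Theory Num.Theory.
Local Open Scope ring_scope.

(* The real-analytic form [sum_inl c |z^mon|^2 - sum_inr c |z^mon|^2] vanishes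
   on the sphere; [x_j] stands for [|z_j|^2]. *)
Record sphere_relation (n a b D : nat) (mon : 'I_a + 'I_b -> 'X_{1..n})
    (c : 'I_a + 'I_b -> nat) : Prop := SphereRelation {
  mon_inj : injective mon;
  coef_gt0 : forall i, (0 < c i)%N;
  has_const : exists i, mon i = 0%MM;
  has_degree : exists i, (D <= mdeg (mon i))%N;
  relation_eq : forall (K : comNzRingType) (x : 'I_n -> K),
    \sum_j x j = 1 ->
    \sum_i (c (inl i))%:R * mmap1 x (mon (inl i))
    = \sum_i (c (inr i))%:R * mmap1 x (mon (inr i))
}.

(** * Linear independence of monomials on a torus *)

Lemma digits_inj (n K : nat) (f g : 'I_n -> nat) :
  (forall i, f i < K)%N -> (forall i, g i < K)%N ->
  (\sum_(i < n) f i * K ^ i = \sum_(i < n) g i * K ^ i)%N -> f =1 g.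
Proof.
elim: n f g => [|n IHn] f g ltfK ltgK; first by move=> _ [].
rewrite !big_ord_recl !muln1.
have shift (h : 'I_n.+1 -> nat) :
    (\sum_(i < n) h (lift ord0 i) * K ^ bump 0 i =
     (\sum_(i < n) h (lift ord0 i) * K ^ i) * K)%N.
  by rewrite big_distrl; apply: eq_bigr => i _; rewrite /= -mulnA -expnSr.
rewrite !shift => eq_fg.
have eq0 : f ord0 = g ord0.
  have := congr1 (modn^~ K) eq_fg.
  by rewrite ![(_ + _ * K)%N]addnC !modnMDl !modn_small.
move/eqP: eq_fg; rewrite eq0 eqn_add2l eqn_pmul2r; last first.
  exact: leq_ltn_trans (ltfK ord0).
move/eqP => /IHn eq_lift i.
by case: (unliftP ord0 i) => [j|] -> //; apply: eq_lift.
Qed.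

Section UnitCircle.
Variable C : numClosedFieldType.

(** Cayley transform of the integer [t]: infinitely many distinct points of the unit circle, too
    many to be roots of a nonzero polynomial. *)
Definition cayley (t : nat) : C := (1 + t%:R * 'i) / (1 - t%:R * 'i).

Lemma cayley_num_neq0 (t : nat) : 1 + t%:R * 'i != 0 :> C.
Proof.
suff : (1 + t%:R * 'i) * (1 - t%:R * 'i) != 0 :> C.
  by rewrite mulf_eq0 negb_or => /andP[].
rewrite mulrC -subr_sqr exprMn sqrCi mulrN1 opprK expr1n -natrX nat1r.
by rewrite pnatr_eq0.
Qed.

Lemma cayley_den_conj (t : nat) : 1 - t%:R * 'i = (1 + t%:R * 'i)^* :> C.
Proof. by rewrite rmorphD rmorphM rmorph1 rmorph_nat /= conjCi mulrN. Qed.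

Lemma cayley_den_neq0 (t : nat) : 1 - t%:R * 'i != 0 :> C.
Proof. by rewrite cayley_den_conj conjC_eq0 cayley_num_neq0. Qed.

Lemma norm_cayley (t : nat) : `|cayley t| = 1.
Proof.
rewrite normf_div cayley_den_conj norm_conjC divff //.
by rewrite normr_eq0 cayley_num_neq0.
Qed.

Lemma cayley_inj : injective cayley.
Proof.
move=> t u /eqP.
rewrite eqr_div ?cayley_den_neq0 // -subr_eq0.
have -> : (1 + t%:R * 'i) * (1 - u%:R * 'i) - (1 + u%:R * 'i) * (1 - t%:R * 'i)
    = 2%:R * 'i * (t%:R - u%:R) :> C by ring.
rewrite !mulf_eq0 pnatr_eq0 (negPf (neq0Ci C)) /= subr_eq0 eqr_nat.
by move/eqP.
Qed.

Lemma poly_circle_eq0 (p : {poly C}) :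
  (forall w : C, `|w| = 1 -> p.[w] = 0) -> p = 0.
Proof.
move=> p0; apply/eqP; apply: contraT => p_neq0.
have := @max_poly_roots _ p (mkseq cayley (size p)) p_neq0.
rewrite size_mkseq ltnn => -> //; last exact: (mkseq_uniq _ cayley_inj).
apply/allP => _ /mapP[t _ ->]; apply/eqP/p0/norm_cayley.
Qed.

(* Kronecker substitution: [z_j = w ^ (K ^ j) / sqrt n] with [|w| = 1] runs
   inside the sphere and sends distinct monomials of degree less than [K] to
   distinct powers of [w]. *)
Lemma monomials_free_on_torus (n : nat) (J : finType) (mon : J -> 'X_{1..n})
    (gam : J -> C) :
  (0 < n)%N -> injective mon ->
  (forall z : 'I_n -> C, (forall j, `|z j| ^+ 2 = n%:R^-1) ->
     \sum_i gam i * mmap1 z (mon i) = 0) ->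
  forall i, gam i = 0.
Proof.
move=> n_gt0 mon_inj gam0 i.
pose K := (\max_i mdeg (mon i)).+1.
pose e i := (\sum_(j < n) mon i j * K ^ j)%N.
have e_inj : injective e.
  have lt_K i' j : (mon i' j < K)%N.
    rewrite ltnS; apply: leq_trans (leq_bigmax i').
    by rewrite mdegE (bigD1 j) //= leq_addr.
  by move=> i1 i2 /digits_inj H; apply/mon_inj/mnmP/H.
pose r : C := (sqrtC n%:R)^-1.
have n_neq0 : n%:R != 0 :> C by rewrite pnatr_eq0 -lt0n.
have r_neq0 : r != 0 by rewrite invr_eq0 sqrtC_eq0.
pose p : {poly C} := \sum_i (gam i * r ^+ mdeg (mon i)) *: 'X^(e i).
have /(congr1 (fun q : {poly C} => q`_(e i))) : p = 0.
  apply: poly_circle_eq0 => w w1.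
  rewrite -[RHS](gam0 (fun j => r * w ^+ (K ^ j))); last first.
    move=> j; rewrite normrM normrX w1 expr1n mulr1 normfV exprVn.
    by rewrite -normrX sqrtCK normr_nat.
  rewrite horner_sum; apply: eq_bigr => k _.
  rewrite hornerZ hornerXn -mulrA /mmap1; congr (_ * _).
  rewrite mdegE -!prodrXr -big_split; apply: eq_bigr => j _ /=.
  by rewrite exprMn -exprM mulnC.
rewrite coef0 coef_sum (bigD1 i) //= big1 => [|k ne_ki]; last first.
  rewrite coefZ coefXn; case: eqP => [/e_inj eq_ik|_]; last by rewrite mulr0.
  by rewrite eq_ik eqxx in ne_ki.
rewrite addr0 coefZ coefXn eqxx mulr1 => /eqP.
by rewrite mulf_eq0 expf_eq0 (negPf r_neq0) andbF orbF => /eqP.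
Qed.

End UnitCircle.

(** * From a sphere relation to a rational map *)

Section RationalMapOfRelation.
Variables (R : realType) (n a b D : nat).
Variables (mon : 'I_a + 'I_b.+1 -> 'X_{1..n}) (c : 'I_a + 'I_b.+1 -> nat).
Hypothesis relP : sphere_relation D mon c.

(** The square root makes [|comp i|^2] the [i]-th term of the relation at $x_j = |z_j|^2$. *)
Let comp (i : 'I_a + 'I_b.+1) : {mpoly R[i]%C[n]} :=
  sqrtC (c i)%:R *: 'X_[mon i].

(** The term [inr ord0] is skipped: it serves as the denominator. *)
Let index (k : 'I_(a + b)) : 'I_a + 'I_b.+1 :=
  match split k with inl j => inl j | inr j => inr (lift ord0 j) end.

Let coef_neq0 i : sqrtC (c i)%:R != 0 :> R[i]%C.
Proof. by rewrite sqrtC_eq0 pnatr_eq0 -lt0n (coef_gt0 relP). Qed.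

Let compE i (z : 'I_n -> R[i]%C) :
  (comp i).@[z] = sqrtC (c i)%:R * mmap1 z (mon i).
Proof. by rewrite mevalZ mevalX. Qed.

Let norm_comp i (z : 'I_n -> R[i]%C) :
  `|(comp i).@[z]| ^+ 2 = (c i)%:R * mmap1 (fun j => `|z j| ^+ 2) (mon i).
Proof.
rewrite compE normrM exprMn -normrX sqrtCK normr_nat; congr (_ * _).
rewrite normr_prod -prodrXl; apply: eq_bigr => j _.
by rewrite normrX -!exprM mulnC.
Qed.

Let comp_neq0 i : comp i != 0.
Proof. by rewrite -msize_poly_eq0 msizeZ // msizeX. Qed.

Let index_l j : index (lshift b j) = inl j.
Proof. by rewrite /index (unsplitK (inl j)). Qed.

Let index_r j : index (rshift a j) = inr (lift ord0 j).
Proof. by rewrite /index (unsplitK (inr j)). Qed.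

Let comp_index i : (i = inr ord0) \/ exists k, i = index k.
Proof.
case: i => [j|j].
  by right; exists (lshift b j); rewrite index_l.
case: (unliftP ord0 j) => [j'|] ->; last by left.
by right; exists (rshift a j'); rewrite index_r.
Qed.

Let lowest_terms (d : {mpoly R[i]%C[n]}) :
  mpoly_dvd d (comp (inr ord0)) ->
  (forall k, mpoly_dvd d (comp (index k))) -> d \is a GRing.unit.
Proof.
move=> d_den d_num; have [i0 mon0] := has_const relP.
have [q] : mpoly_dvd d (comp i0) by case: (comp_index i0) => [|[k]] ->.
rewrite /comp mon0 mpolyX0 -mul_mpolyC mulr1 => eq_qd.
have: (sqrtC (c i0)%:R : R[i]%C)%:MP_[n] \is a GRing.unit.
  by apply: rmorph_unit; rewrite unitfE.
by rewrite eq_qd unitrM => /andP[].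
Qed.

Lemma rational_map_of_relation : (0 < n)%N ->
  exists F : rational_map R n (a + b)%N,
    [/\ maps_sphere_to_hyperquadric F, image_in_no_hyperplane F
      & (D <= rdegree F)%N].
Proof.
move=> n_gt0.
exists (RationalMap (comp_neq0 (inr ord0)) lowest_terms); split.
(* By the relation, all negative terms cancel except that of the denominator $h$, which leaves
   $|h|^2/|h|^2 = 1$. *)
- move=> z; rewrite !inE => /eqP z1 h0.
  under eq_bigr do rewrite mxE normf_div expr_div_n /= index_l norm_comp.
  under [X in _ - X]eq_bigr
    do rewrite mxE normf_div expr_div_n /= index_r norm_comp.
  rewrite -!mulr_suml (relation_eq relP z1) big_ord_recl.
  rewrite mulrDl addrK -norm_comp divff // expf_eq0 /=.
  by rewrite normr_eq0.
- move=> cc d cc_neq0 Hplane.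
  (* Clearing the denominator in the hyperplane equation gives a linear relation among the
     components, with weight [- d] at the denominator. *)
  pose gam i : R[i]%C := sqrtC (c i)%:R *
    match i with
    | inl j => cc 0 (lshift b j)
    | inr j => if unlift ord0 j is Some j' then cc 0 (rshift a j') else - d
    end.
  have gam0 : forall i, gam i = 0.
    apply: (monomials_free_on_torus n_gt0 (mon_inj relP)) => z z_torus.
    (* No coordinate vanishes on the torus, so neither does the monomial denominator. *)
    have ev0 : (comp (inr ord0)).@[z] != 0.
      rewrite compE mulf_neq0 //; apply/prodf_neq0 => j _.
      rewrite expf_neq0 // -normr_eq0 -sqrf_eq0 z_torus invr_eq0.
      by rewrite pnatr_eq0 -lt0n.
    have zE : (fun j => (\row_j z j : 'rV_n) 0 j) =1 z by move=> j; rewrite mxE.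
    have := Hplane (\row_j z j); rewrite !inE /= => H.
    have /eqP : \sum_(j < a + b) cc 0 j *
        ((comp (index j)).@[z] / (comp (inr ord0)).@[z]) == d.
      have := H _; rewrite (meval_eq _ zE) ev0.
      move=> H'; rewrite -(eqP (H' _ isT)).
        by apply/eqP/eq_bigr => j _; rewrite mxE !(meval_eq _ zE).
      apply/eqP; under eq_bigr do rewrite mxE z_torus.
      by rewrite sumr_const card_ord -[LHS]mulr_natr mulVf // pnatr_eq0 -lt0n.
    move=> /(congr1 ( *%R^~ (comp (inr ord0)).@[z])) /eqP.
    rewrite mulr_suml big_split_ord -subr_eq0 => /eqP Hz.
    rewrite -[RHS]Hz big_sumType big_ord_recl /gam /= unlift_none.
    rewrite [X in _ + X]addrC addrA; congr (_ + _ + _).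
    + apply: eq_bigr => j _.
      by rewrite -[RHS]mulrA divfK // index_l compE [RHS]mulrCA mulrA.
    + apply: eq_bigr => j _.
      by rewrite liftK -[RHS]mulrA divfK // index_r compE [RHS]mulrCA mulrA.
    + by rewrite compE mulrN mulNr [X in _ = - X]mulrCA mulrA.
  case/eqP: cc_neq0; apply/rowP => k; rewrite mxE.
  case: (split_ordP k) => j ->.
  + by apply: (mulfI (coef_neq0 (inl j))); rewrite mulr0 -(gam0 (inl j)).
  + apply: (mulfI (coef_neq0 (inr (lift ord0 j)))).
    by rewrite mulr0 -(gam0 (inr (lift ord0 j))) /gam liftK.
- have [i leDi] := has_degree relP; apply: (leq_trans leDi).
  have -> : mdeg (mon i) = (msize (comp i)).-1 by rewrite msizeZ // msizeX.
  rewrite /rdegree leq_max; case: (comp_index i) => [|[k]] -> /=.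
    by rewrite leqnn.
  by rewrite (bigD1 k) //= leq_maxl orbT.
Qed.
End RationalMapOfRelation.

(** * Sequences with prescribed ascents and descents *)

Section Steps.
Local Open Scope nat_scope.

Definition steps (r : rel nat) (x : nat) (s : seq nat) : nat :=
  count id (pairmap r x s).

Definition lt_rel : rel nat := fun x y => x < y.
Definition gt_rel : rel nat := fun x y => y < x.

Lemma steps_cons (r : rel nat) x y s : steps r x (y :: s) = r x y + steps r y s.
Proof. by []. Qed.

Lemma steps_cat (r : rel nat) x s t :
  steps r x (s ++ t) = steps r x s + steps r (last x s) t.
Proof. by rewrite /steps pairmap_cat count_cat. Qed.

Lemma steps_nseq (r : rel nat) x n y :
  irreflexive r -> steps r x (nseq n y) = (0 < n) && r x y.
Proof.
move=> irr; case: n => //= n; rewrite steps_cons.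
have -> : steps r y (nseq n y) = 0.
  by elim: n => //= n IHn; rewrite steps_cons irr.
by rewrite addn0.
Qed.

Lemma steps_iota x y n : x < y ->
  steps lt_rel x (iota y n) = n /\ steps gt_rel x (iota y n) = 0.
Proof.
elim: n x y => [|n IHn] x y ltxy //=; rewrite !steps_cons.
by have [-> ->] := IHn y y.+1 (leqnn _); rewrite /lt_rel /gt_rel; lia.
Qed.

Lemma steps_rev_iota x y n : y + n <= x ->
  steps lt_rel x (rev (iota y n)) = 0 /\ steps gt_rel x (rev (iota y n)) = n.
Proof.
elim: n x => [|n IHn] x ltx //.
rewrite -addn1 iotaD rev_cat /= !steps_cons.
by have [-> ->] := IHn (y + n) (leqnn _); rewrite /lt_rel /gt_rel; lia.
Qed.

Lemma last_iota x y n : last x (iota y n.+1) = y + n.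
Proof. by rewrite -addn1 iotaD last_cat. Qed.

Lemma last_rev_iota x y n : last x (rev (iota y n)) = if n is 0 then x else y.
Proof. by case: n => //= n; rewrite rev_cons last_rcons. Qed.

Lemma last_nseq (x n y : nat) : last x (nseq n.+1 y) = y.
Proof. by elim: n x => //= n IHn x; rewrite -[RHS](IHn y). Qed.

(* The value [s_k] encodes [lambda_k = s_k - 1], which keeps the profile in
   [nat]; hence the default and outer value [1]. Two blocks separated by [D.+1]
   zero coefficients are used: a positive one absorbing all but one of the
   required ascents and descents, and a constant block that is negative as soon
   as [B] asks for negative coefficients. *)
Lemma exists_profile (m A B D : nat) :
  0 < m -> 2 * m ^ 2 + 3 * m + 1 <= A -> 2 <= B ->
  exists s : seq nat,
    [/\ last 1 s = 1, nth 1 s 0 != 1,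
        exists k, D <= k < size s /\ nth 1 (1 :: s) k != nth 1 s k,
        steps gt_rel 1 s + m * count (fun y => 1 < y) s = A
      & steps lt_rel 1 s + m * count (fun y => y == 0) s = B].
Proof.
move=> m_gt0 geA geB.
(* Each of [N] zeros adds [m] to the second total and each of [P] values above 1 adds [m] to the
   first; [u + 2] ascents and [d + 2] descents must supply the rest. *)
pose N := (B - 2) %/ m; pose u := (B - 2) %% m.
pose P := (A - 2) %/ m; pose d := (A - 2) %% m.
have eB : B = N * m + u + 2 by rewrite -divn_eq; lia.
have eA : A = P * m + d + 2 by rewrite -divn_eq; lia.
have ltu : u < m by rewrite ltn_mod.
have ltd : d < m by rewrite ltn_mod.
(* The block needs [u.+1 + d] values above 1 and the tail at most one, in all at most [2 * m], so
   the subtractions in [e] are not truncated. *)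
have geP : 2 * m + 1 <= P by nia.
(* Followed by 1, either form has one ascent and one descent. *)
pose tail := if N == 0 then [:: 2] else nseq N 0.
pose e := P - (N == 0) - u.+1 - d.
have eP : P = (N == 0) + u.+1 + d + e by rewrite /e; case: (N == 0) => /=; lia.
(* The block has [u.+1] ascents, then a plateau padding the number of values above 1, then [d]
   descents; the drop to the gap adds one more descent. *)
pose block := iota d.+2 u.+1 ++ nseq e (d.+2 + u) ++ rev (iota 2 d).
have lt_irr : irreflexive lt_rel by move=> x; rewrite /lt_rel ltnn.
have gt_irr : irreflexive gt_rel by move=> x; rewrite /gt_rel ltnn.
have lastE : last (d.+2 + u) (nseq e (d.+2 + u)) = d.+2 + u.
  by case: (e) => // e'; rewrite last_nseq.
have [up_iota down_iota] := @steps_iota 1 d.+2 u.+1 isT.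
have [up_rev down_rev] : steps lt_rel (d.+2 + u) (rev (iota 2 d)) = 0
    /\ steps gt_rel (d.+2 + u) (rev (iota 2 d)) = d.
  by apply: steps_rev_iota; lia.
have last_block : 1 < last 1 block.
  by rewrite /block !last_cat last_iota lastE last_rev_iota; case: (d).
have up_block : steps lt_rel 1 block = u.+1.
  rewrite /block !steps_cat last_iota lastE up_iota up_rev.
  by rewrite steps_nseq // lt_irr andbF; lia.
have down_block : steps gt_rel 1 block = d.
  rewrite /block !steps_cat last_iota lastE down_iota down_rev.
  by rewrite steps_nseq // gt_irr andbF; lia.
have gt1_block : all (fun y => 1 < y) block.
  rewrite /block !all_cat all_rev all_nseq; apply/and3P; split.
  - by apply/allP => y; rewrite mem_iota; lia.
  - by rewrite orbT.
  - by apply/allP => y; rewrite mem_iota; lia.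
have size_block : size block = u.+1 + e + d.
  by rewrite /block !size_cat size_nseq size_rev !size_iota addnA.
have pos_block : count (fun y => 1 < y) block = u.+1 + e + d.
  by rewrite -size_block; apply/eqP; rewrite -all_count.
have neg_block : count (fun y => y == 0) block = 0.
  apply/eqP; rewrite eqn0Ngt -has_count -all_predC.
  by apply: sub_all gt1_block => y /=; lia.
have [up_tail down_tail] : steps lt_rel 1 (tail ++ [:: 1]) = 1
    /\ steps gt_rel 1 (tail ++ [:: 1]) = 1.
  rewrite /tail; case: eqP => [//|N_neq0].
  rewrite !steps_cat !steps_nseq // lt0n; case: (N) N_neq0 => // N' _.
  by rewrite last_nseq.
have pos_tail : count (fun y => 1 < y) tail = (N == 0).
  by rewrite /tail; case: (N == 0) => //; rewrite count_nseq.
have neg_tail : count (fun y => y == 0) tail = N.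
  by rewrite /tail; case: eqP => [->|_] //; rewrite count_nseq mul1n.
have [y [t [y_neq1 eq_tail]]] : exists y t, y != 1 /\ tail = y :: t.
  rewrite /tail; case: eqP => [_|]; first by exists 2, [::].
  by case: (N) => // N' _; exists 0, (nseq N' 0).
have head_block t' : nth 1 (block ++ t') 0 != 1 by [].
clearbody block tail.
exists (block ++ nseq D.+1 1 ++ tail ++ [:: 1]); split.
- by rewrite !last_cat.
- exact: head_block.
(* The jump sits at the first value of [tail], right after the gap of [D.+1] ones. *)
- rewrite catA; set p := block ++ nseq D.+1 1; exists (size p); split.
    by rewrite /p !size_cat size_nseq /=; lia.
  rewrite -cat_cons !nth_cat /= ltnS leqnn ltnn subnn -last_nth.
  by rewrite /p last_cat last_nseq eq_tail eq_sym.
- rewrite !steps_cat down_block last_nseq !count_cat count_nseq.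
  rewrite -steps_cat down_tail pos_tail pos_block steps_nseq //.
  by rewrite /= /gt_rel last_block eA eP; lia.
- rewrite !steps_cat up_block last_nseq !count_cat count_nseq.
  rewrite -steps_cat up_tail neg_tail neg_block steps_nseq //.
  by rewrite /= /lt_rel ltnNge (ltnW last_block) eB /=; lia.
Qed.
End Steps.

(** * Sphere relations from signed polynomials *)

Lemma relation_of_signed_family (n D : nat) (I : finType)
    (mon : I -> 'X_{1..n}) (coef : I -> int) :
  injective mon ->
  (exists2 i, coef i != 0 & mon i = 0%MM) ->
  (exists2 i, coef i != 0 & (D <= mdeg (mon i))%N) ->
  (forall (K : comNzRingType) (x : 'I_n -> K), \sum_j x j = 1 ->
     \sum_i (coef i)%:~R * mmap1 x (mon i) = 0) ->
  exists (mon' : 'I_#|[pred i | 0 < coef i]| + 'I_#|[pred i | coef i < 0]|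
                 -> 'X_{1..n}) c,
    sphere_relation D mon' c.
Proof.
move=> mon_inj const_in deg_in rel.
(* Terms are sorted by sign and the negative ones moved across the equation; zero coefficients fall
   in neither set. *)
pose pos := [pred i | 0 < coef i]; pose neg := [pred i | coef i < 0].
pose e (j : 'I_#|pos| + 'I_#|neg|) : I :=
  match j with inl j => enum_val j | inr j => enum_val j end.
have posP j : 0 < coef (e (inl j)) by have := enum_valP j.
have negP j : coef (e (inr j)) < 0 by have := enum_valP j.
have e_onto i : coef i != 0 -> exists j, e j = i.
  rewrite neq_lt => /orP[i_neg|i_pos].
  - have i_in : i \in neg by [].
    by exists (inr (enum_rank_in i_in i)); rewrite /= enum_rankK_in.
  - have i_in : i \in pos by [].
    by exists (inl (enum_rank_in i_in i)); rewrite /= enum_rankK_in.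
exists (mon \o e), (fun j => `|coef (e j)|%N); split.
- apply: inj_comp => // -[j1|j1] [j2|j2] eq_e.
  + by congr inl; apply: enum_val_inj.
  + by have := posP j1; rewrite eq_e ltNge (ltW (negP j2)).
  + by have := posP j2; rewrite -eq_e ltNge (ltW (negP j1)).
  + by congr inr; apply: enum_val_inj.
- by case=> j; rewrite absz_gt0 ?(gt_eqF (posP j)) ?(lt_eqF (negP j)).
- by have [i /e_onto[j <-]] := const_in; exists j.
- by have [i /e_onto[j <-]] := deg_in; exists j.
- move=> K x /rel.
  rewrite (bigID pos) /= [X in _ + X](bigID neg) /=.
  rewrite [X in _ + (_ + X)]big1 ?addr0; last first.
    move=> i; rewrite -!leNgt => /andP[i_le0 i_ge0].
    by rewrite (@le_anti _ _ (coef i) 0) ?mul0r ?i_le0.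
  rewrite [X in _ + X](eq_bigl (mem neg)); last first.
    by move=> i; rewrite !inE andb_idl // => /ltW; rewrite leNgt.
  rewrite -/pos (big_enum_val (A := pos)) (big_enum_val (A := neg)) /=.
  have natr_abs z : `|z|%N%:R = `|z|%:~R :> K by rewrite -abszE.
  move=> /eqP; rewrite addr_eq0 -sumrN => /eqP sums_eq.
  under eq_bigr do rewrite natr_abs (gtr0_norm (posP _)).
  under [RHS]eq_bigr do rewrite natr_abs (ltr0_norm (negP _)) mulrNz mulNr.
  exact: sums_eq.
Qed.

Lemma count_ord (T : Type) (x0 : T) (a : pred T) (s : seq T) :
  count a s = (\sum_(k < size s) a (nth x0 s k))%N.
Proof.
by rewrite -sum1_count (big_nth x0) big_mkord big_mkcond; apply: eq_bigr.
Qed.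

Lemma steps_ord (r : rel nat) (x : nat) (s : seq nat) :
  steps r x s = (\sum_(k < size s) r (nth 1 (x :: s) k) (nth 1 s k))%N.
Proof.
rewrite /steps (count_ord false) size_pairmap.
by apply: eq_bigr => k _; rewrite (nth_pairmap 1%N).
Qed.

Definition sum_swap (S T : Type) (i : S + T) : T + S :=
  match i with inl j => inr j | inr j => inl j end.

Lemma sum_swapK (S T : Type) : cancel (@sum_swap S T) (@sum_swap T S).
Proof. by case. Qed.

Lemma sphere_relation_swap (n a b D : nat) (mon : 'I_a + 'I_b -> 'X_{1..n})
    (c : 'I_a + 'I_b -> nat) :
  sphere_relation D mon c ->
  sphere_relation D (mon \o @sum_swap _ _) (c \o @sum_swap _ _).
Proof.
case=> mon_inj c_gt0 [i0 mon0] [i1 deg1] rel; split=> /=.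
- exact: inj_comp mon_inj (can_inj (@sum_swapK _ _)).
- by move=> i; apply: c_gt0.
- by exists (sum_swap i0); rewrite sum_swapK.
- by exists (sum_swap i1); rewrite sum_swapK.
- by move=> K x x1; rewrite -rel.
Qed.

(** * The polynomial $(\sum_j x_j - 1) \sum_k (s_k - 1) x_0^k$ *)

Section ProfileRelation.
Variables (m D : nat) (s : seq nat).
Hypothesis s_last : last 1%N s = 1%N.
Hypothesis s_head : nth 1%N s 0 != 1%N.
Hypothesis s_jump :
  exists k, (D <= k < size s)%N /\ nth 1%N (1%N :: s) k != nth 1%N s k.

(** Exponents [k] below [size s] suffice: [s] ends with 1, so the next power of $x_0$ has
    coefficient zero. *)
Let I := ('I_(size s) * 'I_m.+1)%type.

Let mon (i : I) : 'X_{1..m.+1} :=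
  (U_(ord0) *+ i.1 + (if i.2 == ord0 then 0 else U_(i.2)))%MM.

(** The prepended 1 stands for $\lambda_{-1} = 0$. *)
Let coef (i : I) : int :=
  if i.2 == ord0 then (nth 1 (1 :: s) i.1)%N%:Z - (nth 1 s i.1)%N%:Z
  else (nth 1 s i.1)%N%:Z - 1.

Let mon_inj : injective mon.
Proof.
move=> [k j] [k' j'] /mnmP eq_mon.
have eq_k : k = k' :> nat.
  have := eq_mon ord0; rewrite /mon /= !mnmDE !mulmnE mnm1E eqxx !mul1n.
  have exp0 (i : 'I_m.+1) : (if i == ord0 then 0 else U_(i))%MM ord0 = 0%N.
    by case: ifP => i0; rewrite ?mnm0E ?mnm1E ?i0.
  by rewrite !exp0 !addn0.
congr (_, _); first exact: val_inj.
have := eq_mon j; have := eq_mon j'.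
rewrite /mon /= !mnmDE !mulmnE eq_k => /addnI + /addnI.
case: (eqVneq j ord0) => [->|j0]; case: (eqVneq j' ord0) => [->|j'0] //.
- by rewrite mnm0E !mnm1E eqxx.
- by rewrite !mnm0E !mnm1E eqxx.
- by rewrite !mnm1E eqxx; case: eqP.
Qed.

(** The pure powers of $x_0$ account for the steps of [s], and each of the [m] other variables for
    one copy of the count. *)
Let card_coef (p : pred int) (q : rel nat) (a : pred nat) :
  (forall x y : nat, p (x%:Z - y%:Z) = q x y) ->
  (forall y : nat, p (y%:Z - 1) = a y) ->
  #|[pred i | p (coef i)]| = (steps q 1 s + m * count a s)%N.
Proof.
move=> pq pa; rewrite -sum1_card big_mkcond.
rewrite steps_ord (count_ord 1%N) big_distrr -big_split.
rewrite -(pair_bigA _ (fun k j => if p (coef (k, j)) then 1 else 0)%N) /=.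
apply: eq_bigr => k _; rewrite big_ord_recl /coef /= pq.
rewrite sum_nat_const card_ord pa; by do 2![case: ifP].
Qed.

Lemma relation_of_profile :
  exists (mon' : 'I_(steps gt_rel 1 s + m * count (fun y => 1 < y)%N s)
                 + 'I_(steps lt_rel 1 s + m * count (fun y => y == 0)%N s)
                 -> 'X_{1..m.+1}) c,
    sphere_relation D mon' c.
Proof.
rewrite -(@card_coef (fun z => 0 < z)); first last.
- by move=> y; lia.
- by move=> x y; rewrite /gt_rel; lia.
rewrite -(@card_coef (fun z => z < 0)); first last.
- by move=> y; lia.
- by move=> x y; rewrite /lt_rel; lia.
have [k [/andP[leDk ltks] jump]] := s_jump.
apply: (relation_of_signed_family mon_inj).
- have s_gt0 : (0 < size s)%N by case: (s) s_head.
  exists (Ordinal s_gt0, ord0); first by rewrite /coef /=; lia.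
  by rewrite /mon /= mulm0n addm0.
- exists (Ordinal ltks, ord0); first by rewrite /coef /= subr_eq0 eqz_nat.
  by rewrite /mon /= addm0 mdegMn mdeg1 mul1n.
move=> K x x1.
rewrite -(pair_bigA _ (fun k j => (coef (k, j))%:~R * mmap1 x (mon (k, j)))) /=.
have mmap1_mon k' j : mmap1 x (mon (k', j))
    = x ord0 ^+ k' * (if j == ord0 then 1 else x j).
  rewrite -[LHS]mevalX mpolyXD mevalM -mpolyXn rmorphXn /= mevalXU.
  by case: (j == ord0); rewrite ?mpolyX0 ?mevalXU ?rmorph1.
(* This is $-\lambda_{k'-1} x_0^{k'}$. As the other variables sum to $1 - x_0$, the terms with
   exponent [k'] add up to [f k'.+1 - f k']; both ends vanish because [s] is preceded by 1 and ends
   with 1. *)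
pose f k' : K := x ord0 ^+ k' * (1 - (nth 1 (1 :: s) k')%N%:R).
transitivity (\sum_(0 <= k' < size s) (f k'.+1 - f k')); last first.
  by rewrite telescope_sumr // /f -last_nth s_last /= !subrr !mulr0 subr0.
rewrite big_mkord; apply: eq_bigr => k' _.
rewrite big_ord_recl mmap1_mon /=.
under eq_bigr do rewrite mmap1_mon /coef /= mulrA.
rewrite -mulr_sumr.
have -> : \sum_(i < m) x (lift ord0 i) = 1 - x ord0.
  by rewrite -x1 big_ord_recl addrAC subrr add0r.
rewrite /f /coef /= !rmorphB /= exprS -!pmulrn.
ring.
Qed.
End ProfileRelation.

Theorem corollary8p2 (R : realType) (n : nat) (hn : (2 <= n)%N)
    (A B : nat) (hA : (2 <= A)%N) (hB : (2 <= B)%N)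
    (hAB : (2 * (2 * n ^ 2 - n) <= A + B)%N) :
  forall D : nat, exists F : rational_map R n (A + (B - 1))%N,
    [/\ maps_sphere_to_hyperquadric F,
        image_in_no_hyperplane F
      & (D <= rdegree F)%N].
Proof.
move=> D.
have [m m_gt0 en] : exists2 m, (0 < m)%N & n = m.+1 by exists n.-1; lia.
subst n.
(* For $n = m + 1$ this bound is $2n^2 - n$, half the lower bound on $A + B$, so [A] or [B] reaches
   it. *)
have relation a b : (2 * m ^ 2 + 3 * m + 1 <= a)%N -> (2 <= b)%N ->
    exists (mon : 'I_a + 'I_b -> 'X_{1..m.+1}) c, sphere_relation D mon c.
  move=> le_a le_b.
  have [s [s_last s_head s_jump <- <-]] := exists_profile D m_gt0 le_a le_b.
  exact: relation_of_profile.
have [mon [c rel]] :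
    exists (mon : 'I_A + 'I_B -> 'X_{1..m.+1}) c, sphere_relation D mon c.
  have [geA|ltA] := leqP (2 * m ^ 2 + 3 * m + 1) A; first exact: relation.
  have [|//|mon [c rel]] := relation B A; first by nia.
  exists (mon \o @sum_swap _ _), (c \o @sum_swap _ _).
  exact: sphere_relation_swap.
case: B => // b in hB hAB mon c rel *; rewrite subn1.
exact: rational_map_of_relation rel _.
Qed.
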